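(* Let $A$ be an $N\times N$ real symmetric matrix with smallest eigenvalue $\lambda_1$, and let $\gamma>\max(0,-\lambda_1)$. Define $F_A:\mathbb{R}^N\to\mathbb{R}$ by $F_A(x)=\frac12\langle x,Ax\rangle+\frac{\gamma}{2}\|x\|^2-\gamma\|x\|$. Then any local minimizer $x_*$ of $F_A$ is a global minimizer of $F_A$.
   Context: $\langle\cdot,\cdot\rangle$ and $\|\cdot\|$ denote the Euclidean inner product and norm on $\mathbb{R}^N$. *)

(* Defs.v *)
From mathcomp Require Import all_boot all_order all_algebra.
From mathcomp Require Import sesquilinear reals.

Set Implicit Arguments.
Unset Strict Implicit.
Unset Printing Implicit Defensive.

Import Order.TTheory GRing.Theory Num.Theory.

Local Open Scope ring_scope.

(* The library norm on matrices is the sup norm, hence the Euclidean [enorm]. *)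
Definition dot (R : realType) (N : nat) (x y : 'cV[R]_N) : R :=
  \sum_(i < N) x i 0 * y i 0.

Definition enorm (R : realType) (N : nat) (x : 'cV[R]_N) : R :=
  Num.sqrt (dot x x).

(* [eigenvalue] is defined with row eigenvectors; a matrix and its transpose
   have the same eigenvalues. *)
Definition smallest_eigenvalue (R : realType) (N : nat) (A : 'M[R]_N) (l : R) :
    Prop :=
  eigenvalue A l /\ forall mu : R, eigenvalue A mu -> l <= mu.

Definition local_minimizer (R : realType) (N : nat) (f : 'cV[R]_N -> R)
    (x : 'cV[R]_N) : Prop :=
  exists2 e : R, 0 < e & forall y : 'cV[R]_N, enorm (y - x) < e -> f x <= f y.

Definition global_minimizer (R : realType) (N : nat) (f : 'cV[R]_N -> R)
    (x : 'cV[R]_N) : Prop :=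
  forall y : 'cV[R]_N, f x <= f y.

Definition FA (R : realType) (N : nat) (A : 'M[R]_N) (gamma : R)
    (x : 'cV[R]_N) : R :=
  1 / 2 * dot x (A *m x) + gamma / 2 * enorm x ^+ 2 - gamma * enorm x.

(* Main.v *)
Require Import Defs.
From mathcomp Require Import all_boot all_order all_algebra.
From mathcomp Require Import sesquilinear reals.
From mathcomp Require Import ring lra.
Import Order.TTheory GRing.Theory Num.Theory.
Local Open Scope ring_scope.

(** Write a nonzero local minimizer as [x], put [r = ||x||] and let
    [mu = <x, A x> / r^2] be its Rayleigh quotient.

    Along the ray through [x] the function is a quadratic polynomial in the
    scaling factor, and stationarity at [x] reads [mu + gamma = gamma / r].

    On the sphere of radius [r] only the term [<y, A y> / 2] of the function
    varies, so the quadratic form [q y = <y, A y> - mu ||y||^2] is nonnegative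
    at the points of the sphere near [x], hence, being homogeneous, on a whole
    neighbourhood of [x] ([rayleigh_near_local_minimizer]).  As [q x = 0], the
    parallelogram law gives [q (x + t v) + q (x - t v) = 2 t^2 q v], so [q] is
    nonnegative everywhere ([rayleigh_global]): the quadratic form of [A] has no
    non-global local minimizer on a sphere.

    With [mu + gamma = gamma / r] ([local_minimizer_radial]), it follows that
    [FA A gamma y >= gamma / (2 r) s^2 - gamma s] where [s = ||y||], and the
    right-hand side is least at [s = r], where it is the value at [x].

    The origin is not a local minimizer when the space is nonzero, because
    [- gamma ||y||] dominates the quadratic terms near it
    ([not_local_minimizer0]). *)

Section EuclideanDot.
Context {R : realType} {N : nat}.
Implicit Types (x y z : 'cV[R]_N) (A : 'M[R]_N) (t : R).

Lemma dotDl x y z : dot (x + y) z = dot x z + dot y z.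
Proof. by rewrite -big_split; apply: eq_bigr => i _; rewrite mxE mulrDl. Qed.

Lemma dotC x y : dot x y = dot y x.
Proof. by apply: eq_bigr => i _; rewrite mulrC. Qed.

Lemma dotDr x y z : dot z (x + y) = dot z x + dot z y.
Proof. by rewrite dotC dotDl !(dotC z). Qed.

Lemma dotZl t x y : dot (t *: x) y = t * dot x y.
Proof. by rewrite mulr_sumr; apply: eq_bigr => i _; rewrite mxE mulrA. Qed.

Lemma dotZr t x y : dot x (t *: y) = t * dot x y.
Proof. by rewrite dotC dotZl dotC. Qed.

Lemma dotNl x y : dot (- x) y = - dot x y.
Proof. by rewrite -scaleN1r dotZl mulN1r. Qed.

Lemma dotNr x y : dot x (- y) = - dot x y.
Proof. by rewrite dotC dotNl dotC. Qed.

Definition dotE := (dotDl, dotDr, dotNl, dotNr, dotZl, dotZr).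

Lemma dot_ge0 x : 0 <= dot x x.
Proof. by apply: sumr_ge0 => i _; rewrite -expr2 sqr_ge0. Qed.

Lemma dot_eq0 x : dot x x = 0 -> x = 0.
Proof.
move=> /eqP; rewrite psumr_eq0 => [/allP x0|i _]; last by rewrite -expr2 sqr_ge0.
apply/colP => i; rewrite mxE; apply/eqP.
by have := x0 i (mem_index_enum i); rewrite /= mulf_eq0 orbb.
Qed.

Lemma enorm_ge0 x : 0 <= enorm x.
Proof. exact: sqrtr_ge0. Qed.

Lemma sqr_enorm x : enorm x ^+ 2 = dot x x.
Proof. by rewrite sqr_sqrtr ?dot_ge0. Qed.

Lemma enorm_gt0 x : x != 0 -> 0 < enorm x.
Proof.
move=> x0; rewrite lt_def enorm_ge0 andbT; apply: contra_neq x0 => e0.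
by apply: dot_eq0; rewrite -sqr_enorm e0 expr0n.
Qed.

Lemma enormZ t x : enorm (t *: x) = `|t| * enorm x.
Proof.
by rewrite /enorm !dotE mulrA -expr2 sqrtrM ?sqr_ge0 // sqrtr_sqr.
Qed.

Lemma enorm_lt x t : 0 <= t -> (enorm x < t) = (dot x x < t ^+ 2).
Proof. by move=> t0; rewrite -sqr_enorm ltr_pXn2r // nnegrE enorm_ge0. Qed.

(** With [r = ||x||] and [y' = (r / ||y||) y] one has
    [||y - x||^2 = (||y|| - r)^2 + (||y|| / r) ||y' - x||^2], while
    [||y|| >= r / 2] by the parallelogram law. *)
Lemma enorm_radial_projection x y :
    0 < enorm x -> enorm (y - x) < enorm x / 2 ->
  0 < enorm y /\
  dot ((enorm x / enorm y) *: y - x) ((enorm x / enorm y) *: y - x)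
    <= 2 * dot (y - x) (y - x).
Proof.
set r := enorm x; set s := enorm y; set d := dot (y - x) (y - x) => r0.
rewrite enorm_lt ?divr_ge0 ?enorm_ge0 // -/d => near.
have xx : dot x x = r ^+ 2 by rewrite sqr_enorm.
have yy : dot y y = s ^+ 2 by rewrite sqr_enorm.
have dE : d = s ^+ 2 + r ^+ 2 - 2 * dot x y.
  by rewrite /d !dotE (dotC y x) xx yy; ring.
have d0 : 0 <= d by exact: dot_ge0.
have par : r ^+ 2 <= 2 * s ^+ 2 + 2 * d.
  rewrite -subr_ge0; have := dot_ge0 (2 *: y - x).
  by congr (0 <= _); rewrite dE !dotE (dotC y x) xx yy; ring.
have s0 : 0 <= s by exact: enorm_ge0.
have s2 : r / 2 <= s by nra.
have sp : 0 < s by lra.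
split=> //.
have -> : dot ((r / s) *: y - x) ((r / s) *: y - x)
          = r / s * (d - (s - r) ^+ 2).
  by rewrite dE !dotE (dotC y x) xx yy; field; lra.
have rs : r / s <= 2 by rewrite ler_pdivrMr //; lra.
have rs0 : 0 <= r / s by rewrite divr_ge0 // ltW.
have : 0 <= r / s * (s - r) ^+ 2 by rewrite mulr_ge0 // sqr_ge0.
by have : r / s * d <= 2 * d by [rewrite ler_wpM2r]; lra.
Qed.

End EuclideanDot.

Section QuadraticPerturbation.
Context {R : realType}.
Implicit Types a b d h : R.

Lemma linear_term_ge0 a b d : 0 < d ->
  (forall h, 0 < h < d -> 0 <= h * b + h ^+ 2 * a) -> 0 <= b.
Proof.
move=> d0 pos; rewrite leNgt; apply/negP => b0.
have c0 : 0 < `|a| + 1 by rewrite ltr_wpDl.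
(* small enough for the quadratic term to be at most half the linear one *)
pose h := Num.min (d / 2) (- b / (2 * (`|a| + 1))).
have h0 : 0 < h by rewrite lt_min !divr_gt0 ?oppr_gt0 ?mulr_gt0.
have hd : h < d by rewrite gt_min ltr_pdivrMr // mulr2n mulrDr mulr1 ltrDl d0.
have hb : h * (2 * (`|a| + 1)) <= - b.
  by rewrite -ler_pdivlMr ?mulr_gt0 // ge_min lexx orbT.
have := pos h; rewrite h0 hd expr2 -mulrA -mulrDr pmulr_rge0 // => /(_ isT).
have : h * a <= h * `|a| by rewrite ler_pM2l // ler_norm.
by lra.
Qed.

Lemma linear_term_eq0 a b d : 0 < d ->
  (forall h, `|h| < d -> 0 <= h * b + h ^+ 2 * a) -> b = 0.
Proof.
move=> d0 pos; apply/eqP; rewrite eq_le -oppr_ge0; apply/andP; split.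
  apply: (linear_term_ge0 a _ d d0) => h /andP[h0 hd].
  by have := pos (- h); rewrite normrN gtr0_norm // sqrrN mulNr mulrN; apply.
apply: (linear_term_ge0 a _ d d0) => h /andP[h0 hd].
by apply: pos; rewrite gtr0_norm.
Qed.

End QuadraticPerturbation.

Section LocalMinimizers.
Context {R : realType} {N : nat}.
Implicit Types (x y v : 'cV[R]_N) (A : 'M[R]_N) (t gamma : R).

Lemma FA_scale A gamma x t : 0 <= t ->
  FA A gamma (t *: x)
  = t ^+ 2 * (1 / 2 * dot x (A *m x) + gamma / 2 * enorm x ^+ 2)
    - t * (gamma * enorm x).
Proof.
by move=> t0; rewrite /FA -scalemxAr enormZ (ger0_norm t0) !dotE; ring.
Qed.

(** Along a ray [- gamma ||y||] is linear with negative slope, and the other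
    terms are quadratic. *)
Lemma not_local_minimizer0 A gamma y : 0 < gamma -> y != 0 ->
  ~ local_minimizer (FA A gamma) 0.
Proof.
move=> g0 /enorm_gt0 y0 [e e0 min0].
set a := 1 / 2 * dot y (A *m y) + gamma / 2 * enorm y ^+ 2.
suff : 0 <= - (gamma * enorm y) by rewrite oppr_ge0 leNgt mulr_gt0.
apply: (linear_term_ge0 a _ (e / enorm y)); first exact: divr_gt0.
move=> h /andP[h0 he]; have := min0 (h *: y).
rewrite subr0 enormZ gtr0_norm // -ltr_pdivlMr // => /(_ he).
rewrite -(scale0r y) !FA_scale ?(ltW h0) // -/a.
by lra.
Qed.

(** The derivative of [s |-> FA A gamma (s *: x)], a quadratic polynomial for
    [s >= 0], vanishes at [s = 1]. *)
Lemma local_minimizer_radial A gamma x : x != 0 ->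
    local_minimizer (FA A gamma) x ->
  dot x (A *m x) + gamma * enorm x ^+ 2 = gamma * enorm x.
Proof.
move=> /enorm_gt0 x0 [e e0 minx].
pose a := 1 / 2 * dot x (A *m x) + gamma / 2 * enorm x ^+ 2.
suff : 2 * a - gamma * enorm x = 0 by rewrite /a; lra.
apply: (linear_term_eq0 a _ (Num.min 1 (e / enorm x))).
  by rewrite lt_min ltr01 divr_gt0.
move=> h; rewrite lt_min => /andP[h1 he].
have h10 : 0 <= 1 + h by move: h1; rewrite ltr_norml => /andP[]; lra.
have := minx ((1 + h) *: x).
rewrite scalerDl scale1r addrC addKr enormZ -ltr_pdivlMr // => /(_ he).
rewrite -[X in X + h *: _]scale1r -scalerDl -[X in FA _ _ X <= _]scale1r.
by rewrite !FA_scale // -/a; nra.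
Qed.

(** A point [y] near [x] has a radial projection to the sphere through [x] that
    is near [x] too, and there the comparison of the values of [FA A gamma]
    is one of the quadratic forms of [A]; homogeneity brings it back to [y]. *)
Lemma rayleigh_near_local_minimizer A gamma x : x != 0 ->
    local_minimizer (FA A gamma) x ->
  exists2 e : R, 0 < e & forall y, enorm (y - x) < e ->
    dot x (A *m x) / enorm x ^+ 2 * dot y y <= dot y (A *m y).
Proof.
move=> /enorm_gt0 x0 [e e0 minx].
exists (Num.min (enorm x / 2) (e / 2)); first by rewrite lt_min !divr_gt0.
move=> y; rewrite lt_min => /andP[/(enorm_radial_projection _ _ x0)[y0 proj]].
rewrite enorm_lt ?divr_ge0 // ?(ltW e0) // => near.
set t := enorm x / enorm y in proj.
have t0 : 0 < t by rewrite divr_gt0.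
have tyx : enorm (t *: y - x) < e.
  rewrite enorm_lt ?(ltW e0) //; apply: le_lt_trans proj _.
  by have := exprn_gt0 2 e0; nra.
have := minx _ tyx.
have ty : enorm (t *: y) = enorm x.
  by rewrite enormZ gtr0_norm // divfK // gt_eqF.
rewrite /FA ty -scalemxAr !dotE -sqr_enorm => le.
have {le} : dot x (A *m x) <= t ^+ 2 * dot y (A *m y) by rewrite expr2; lra.
rewrite /t expr_div_n mulrAC ler_pdivlMr ?exprn_gt0 //.
by rewrite [_ / _ * _]mulrAC ler_pdivrMr ?exprn_gt0 // [X in _ -> _ <= X]mulrC.
Qed.

(** A quadratic form that vanishes at [x] and is nonnegative near [x] is
    nonnegative everywhere, by the parallelogram law at [x + t v] and
    [x - t v]. *)
Lemma rayleigh_global A gamma x v : x != 0 ->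
    local_minimizer (FA A gamma) x ->
  dot x (A *m x) / enorm x ^+ 2 * dot v v <= dot v (A *m v).
Proof.
move=> x0 /(rayleigh_near_local_minimizer _ _ _ x0)[e e0 near].
have [->|/enorm_gt0 v0] := eqVneq v 0.
  by rewrite mulmx0 /dot [X in _ * X]big1 ?mulr0 ?sumr_ge0 // => i _;
    rewrite mxE mul0r.
pose t := e / 2 / enorm v.
have t0 : 0 < t by rewrite !divr_gt0.
have tv : enorm (t *: v) < e.
  by rewrite enormZ gtr0_norm // divfK ?gt_eqF // ltr_pdivrMr //; lra.
have := near (x + t *: v); rewrite addrC addKr => /(_ tv).
have := near (x - t *: v); rewrite addrC addKr -scaleNr enormZ normrN -enormZ.
move=> /(_ tv).
have rx : dot x (A *m x) / enorm x ^+ 2 * dot x x = dot x (A *m x).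
  by rewrite -sqr_enorm divfK // expf_eq0 /= gt_eqF ?enorm_gt0.
move: rx; set mu := _ / _ => rx.
rewrite !mulmxDr -!scalemxAr !dotE => lem lep.
rewrite -(ler_pM2l (exprn_gt0 2 t0)).
by rewrite expr2; nra.
Qed.

End LocalMinimizers.

Theorem theorem1 (R : realType) (N : nat) (A : 'M[R]_N) (lambda1 gamma : R)
  (hA : A \is symmetricmx)
  (hlambda1 : smallest_eigenvalue A lambda1)
  (hgamma : Num.max 0 (- lambda1) < gamma)
  (xstar : 'cV[R]_N)
  (hxstar : local_minimizer (FA A gamma) xstar) :
  global_minimizer (FA A gamma) xstar.
Proof.
have g0 : 0 < gamma by move: hgamma; rewrite gt_max => /andP[].
move=> y; have [x0|x0] := eqVneq xstar 0.
  have [->|y0] := eqVneq y 0; first by rewrite x0.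
  by rewrite x0 in hxstar; case: (not_local_minimizer0 A gamma y g0 y0).
have := rayleigh_global A gamma xstar y x0 hxstar.
have := local_minimizer_radial A gamma xstar x0 hxstar.
have r0 := enorm_gt0 _ x0.
rewrite /FA -sqr_enorm; set r := enorm xstar in r0 *; set s := enorm y.
move=> rad; have -> : dot xstar (A *m xstar) = gamma * r - gamma * r ^+ 2 by lra.
have -> : (gamma * r - gamma * r ^+ 2) / r ^+ 2 = gamma / r - gamma.
  by field; rewrite gt_eqF.
move=> le.
(* the gap between the lower bound at y and the value at xstar, doubled *)
have : 0 <= gamma / r * (s - r) ^+ 2.
  by rewrite mulr_ge0 ?sqr_ge0 // divr_ge0 // ltW.
have -> : gamma / r * (s - r) ^+ 2
          = gamma / r * s ^+ 2 - 2 * gamma * s + gamma * r.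
  by field; rewrite gt_eqF.
by lra.
Qed.
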